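(* Let $m\ge1$, let $(T_0,R_0)$ and $(T_1,R_1)$ be pairs of not necessarily commuting contractions on a Hilbert space, and let $f$ be an analytic polynomial in two variables of degree at most $m$ in each variable. Then $$f(T_1,R_1)-f(T_0,R_1)=\sum_{\xi,\eta\in\Pi_m}\Upsilon_m(\overline\xi T_1)(T_1-T_0)\,\Upsilon_m(\overline\eta T_0)\,(\mathfrak{D}^{[1]}f)(\xi,\eta,R_1)$$ and $$f(T_0,R_1)-f(T_0,R_0)=\sum_{\xi,\eta\in\Pi_m}(\mathfrak{D}^{[2]}f)(T_0,\xi,\eta)\,\Upsilon_m(\overline\xi R_1)(R_1-R_0)\,\Upsilon_m(\overline\eta R_0).$$
   Context: $\Pi_m=\{\xi\in\mathbb{T}:\xi^m=1\}$ and $\Upsilon_m(\zeta)=\frac1m\sum_{k=0}^{m-1}\zeta^k$. An analytic polynomial in two variables is $f(\zeta,\tau)=\sum_{j,k\ge0}\widehat f(j,k)\zeta^j\tau^k$ (finite sum), and $f(T,R)=\sum_{j,k}\widehat f(j,k)T^jR^k$. Divided differences: $(\mathfrak{D}^{[1]}f)(\zeta_1,\zeta_2,\tau)=\frac{f(\zeta_1,\tau)-f(\zeta_2,\tau)}{\zeta_1-\zeta_2}$ if $\zeta_1\ne\zeta_2$, and $=\frac{\partial f}{\partial\zeta}(\zeta_1,\tau)$ if $\zeta_1=\zeta_2$; $(\mathfrak{D}^{[2]}f)(\zeta,\tau_1,\tau_2)=\frac{f(\zeta,\tau_1)-f(\zeta,\tau_2)}{\tau_1-\tau_2}$ if $\tau_1\ne\tau_2$,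 and $=\frac{\partial f}{\partial\tau}(\zeta,\tau_1)$ if $\tau_1=\tau_2$. For fixed $\xi,\eta$, $(\mathfrak{D}^{[1]}f)(\xi,\eta,R_1)$ is the polynomial $\tau\mapsto(\mathfrak{D}^{[1]}f)(\xi,\eta,\tau)$ evaluated at $R_1$, and $(\mathfrak{D}^{[2]}f)(T_0,\xi,\eta)$ is the polynomial $\zeta\mapsto(\mathfrak{D}^{[2]}f)(\zeta,\xi,\eta)$ evaluated at $T_0$. *)

(* Defs.v *)
From HB Require Import structures.
From mathcomp Require Import all_boot all_order all_algebra.
From mathcomp Require Import complex.
From mathcomp Require Import all_classical reals normedtype.

Set Implicit Arguments.
Unset Strict Implicit.
Unset Printing Implicit Defensive.

Import Order.TTheory GRing.Theory Num.Theory.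
Import numFieldNormedType.Exports.

Local Open Scope classical_set_scope.
Local Open Scope ring_scope.

Section Polynomials.
Context {C : numClosedFieldType}.
Implicit Types (m : nat) (f : {poly {poly C}}) (z t : C).

Definition unit_roots m : set C := [set xi | `|xi| = 1 /\ xi ^+ m = 1].

(* The sums over [unit_roots m] use [\sum_(i \in A)], which is only meaningful
   for a finite support. *)
Lemma finite_unit_roots m : (0 < m)%N -> finite_set (unit_roots m).
Proof.
move=> m_gt0; have p_neq0 : 'X^m - 1 != 0 :> {poly C}.
  by rewrite -size_poly_eq0 size_XnsubC.
have [s Hs] := closed_field_poly_normal ('X^m - 1 : {poly C}).
apply: (@sub_finite_set _ _ [set` s]); last exact: finite_seq.
move=> x [_ xm1] /=; suff: root ('X^m - 1 : {poly C}) x.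
  by rewrite Hs rootZ ?lead_coef_eq0// root_prod_XsubC.
by rewrite rootE !hornerE xm1 subrr.
Qed.

Definition Upsilon m : {poly C} := m%:R^-1 *: \sum_(k < m) 'X^k.

(* A two-variable polynomial f(zeta, tau) is an element of {poly {poly C}} whose
   outer variable is zeta: the coefficient of zeta^j tau^k is f`_j`_k. *)
Definition eval2 f z t : C := f.[z%:P].[t].

Definition degree_le m f : Prop :=
  (size f <= m.+1)%N /\ forall j, (size (f`_j)%R <= m.+1)%N.

Definition dzeta f : {poly {poly C}} := f^`().
Definition dtau f : {poly {poly C}} := map_poly (@deriv C) f.

Definition divdiff1 f z1 z2 t : C :=
  if z1 == z2 then eval2 (dzeta f) z1 t
  else (eval2 f z1 t - eval2 f z2 t) / (z1 - z2).

Definition divdiff2 f z t1 t2 : C :=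
  if t1 == t2 then eval2 (dtau f) z t1
  else (eval2 f z t1 - eval2 f z t2) / (t1 - t2).

(* f(z, .) and f(., t) as one-variable polynomials *)
Definition fix_zeta f z : {poly C} := f.[z%:P].
Definition fix_tau f t : {poly C} := map_poly (horner_eval t) f.

(* tau |-> divdiff1 f z1 z2 tau and zeta |-> divdiff2 f zeta t1 t2 as
   polynomials; see [divdiff1_polyE] and [divdiff2_polyE]. *)
Definition divdiff1_poly f z1 z2 : {poly C} :=
  if z1 == z2 then fix_zeta (dzeta f) z1
  else (z1 - z2)^-1 *: (fix_zeta f z1 - fix_zeta f z2).

Definition divdiff2_poly f t1 t2 : {poly C} :=
  if t1 == t2 then fix_tau (dtau f) t1
  else (t1 - t2)^-1 *: (fix_tau f t1 - fix_tau f t2).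

Lemma eval2E f z t :
  eval2 f z t = \sum_(j < size f) \sum_(k < size (f`_j)%R) f`_j`_k * z ^+ j * t ^+ k.
Proof.
rewrite /eval2 (horner_coef f) horner_sum; apply: eq_bigr => j _.
rewrite -polyC_exp hornerM hornerC horner_coef mulr_suml.
by apply: eq_bigr => k _; rewrite mulrAC.
Qed.

Lemma fix_tauE f z t : (fix_tau f t).[z] = eval2 f z t.
Proof.
rewrite eval2E /fix_tau /map_poly horner_poly; apply: eq_bigr => j _.
rewrite /horner_eval horner_coef mulr_suml.
by apply: eq_bigr => k _; rewrite mulrAC.
Qed.

Lemma divdiff1_polyE f z1 z2 t :
  (divdiff1_poly f z1 z2).[t] = divdiff1 f z1 z2 t.
Proof.
rewrite /divdiff1_poly /divdiff1; case: ifP => // _.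
by rewrite hornerZ hornerD hornerN mulrC.
Qed.

Lemma divdiff2_polyE f z t1 t2 :
  (divdiff2_poly f t1 t2).[z] = divdiff2 f z t1 t2.
Proof.
rewrite /divdiff2_poly /divdiff2; case: ifP => _; first exact: fix_tauE.
by rewrite hornerZ hornerD hornerN !fix_tauE mulrC.
Qed.

End Polynomials.

Section Operators.
Context {C : numClosedFieldType} {H : normedModType C}.
Implicit Types (T S : H -> H).

Definition contraction_op T : Prop := forall x, `|T x| <= `|x|.

(* Operators are functions H -> H, added and scaled pointwise; the product is
   composition and the n-th power is [iter n]. *)
Definition op_eval (p : {poly C}) T : H -> H :=
  \sum_(k < size p) p`_k *: (iter k T : H -> H).

Definition op_eval2 (f : {poly {poly C}}) T S : H -> H :=
  \sum_(j < size f) \sum_(k < size (f`_j)%R) f`_j`_k *: (iter j T \o iter k S : H -> H).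

End Operators.

(* Main.v *)
(** Orthogonality of the characters of the group of [m]-th roots of unity gives
    the operator interpolation formula [sum_xi xi^a Upsilon_m(xi^* T) = T^a] for
    [a < m]. The divided difference of [zeta^n] is the sum of
    [zeta_1^(n-1-a) zeta_2^a] over [a < n], so interpolating in both [xi] and
    [eta] turns the right-hand sides into the telescoping sums
    [T^n - S^n = sum_(a < n) T^(n-1-a) (T - S) S^a]; all exponents are below [m]
    because [f] has degree at most [m] in each variable. Everything then follows
    by linearity in [f]. *)
Require Import Defs.
From HB Require Import structures.
From mathcomp Require Import all_boot all_order all_algebra.
From mathcomp Require Import cyclic separable cyclotomic.
From mathcomp Require Import zify complex.
From mathcomp Require Import all_classical reals normedtype.

Set Implicit Arguments.
Unset Strict Implicit.
Unset Printing Implicit Defensive.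

Import Order.TTheory GRing.Theory Num.Theory.
Import numFieldNormedType.Exports.

Local Open Scope classical_set_scope.
Local Open Scope ring_scope.

(** * Roots of unity and interpolation of powers *)

Section RootsOfUnity.
Context {C : numClosedFieldType}.
Implicit Types (m : nat) (z : C).

(** In characteristic zero ['X^m - 1] is separable, so it has [m] distinct roots, and a finite group
    of roots of unity is cyclic. *)
Lemma closed_prim_root_exists m : (0 < m)%N -> exists z : C, m.-primitive_root z.
Proof.
move=> m_gt0; have lead1 : lead_coef ('X^m - 1 : {poly C}) = 1.
  exact/eqP/monicXnsubC.
have [s] := closed_field_poly_normal ('X^m - 1 : {poly C}).
rewrite lead1 scale1r => Hs.
have root_s : all m.-unity_root s.
  by apply/allP => x xs; rewrite /root_of_unity Hs root_prod_XsubC.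
have uniq_s : uniq s.
  rewrite -separable_prod_XsubC -Hs separable_Xn_sub_1 //.
  by rewrite pnatr_eq0 -lt0n.
have size_s : (m <= size s)%N.
  by rewrite -ltnS -(size_prod_XsubC s id) -Hs size_XnsubC.
by have /hasP[z _ zm] := has_prim_root m_gt0 root_s uniq_s size_s; exists z.
Qed.

Lemma norm_unity_root m z : (0 < m)%N -> z ^+ m = 1 -> `|z| = 1.
Proof.
move=> m_gt0 zm1; apply/eqP; rewrite -(@pexpr_eq1 _ _ m) ?normr_ge0 //.
by rewrite -normrX zm1 normr1.
Qed.

(** A primitive root enumerates the set without repetition; sums over ordinals can then be exchanged
    with the sums over exponents. *)
Lemma fsbig_unit_roots (V : nmodType) m z (F : C -> V) :
  m.-primitive_root z ->
  \sum_(xi \in unit_roots m) F xi = \sum_(i < m) F (z ^+ i).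
Proof.
move=> zm; rewrite (fsbig_ord _ m (fun i => F (z ^+ i))).
apply: (@reindex_fsbig V 0 +%R nat C (fun i => z ^+ i) `I_m (unit_roots m)).
have m_gt0 := prim_order_gt0 zm; have zm1 := prim_expr_order zm.
split.
- move=> i /= _; have zi1 : (z ^+ i) ^+ m = 1.
    by rewrite exprAC zm1 expr1n.
  by split; [exact: (norm_unity_root m_gt0)|].
- move=> i j /set_mem /= im /set_mem /= jm /eqP.
  by rewrite (eq_prim_root_expr zm) !modn_small // => /eqP.
- by move=> x [_ /(prim_rootP zm)[i ->]]; exists (nat_of_ord i) => /=.
Qed.

(** Conjugation inverts numbers of modulus 1, so this is a geometric sum of ratio
    [w = z ^+ a / z ^+ k]. For [a != k], both below [m], [w] differs from 1 while [w ^+ m = 1],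
    hence the sum vanishes. *)
Lemma prim_root_orthogonality m z a k : m.-primitive_root z ->
  (a < m)%N -> (k < m)%N ->
  \sum_(i < m) (z ^+ i) ^+ a * (z ^+ i)^* ^+ k = m%:R *+ (a == k).
Proof.
move=> zm am km; have m_gt0 := prim_order_gt0 zm.
have zm1 := prim_expr_order zm; have z_neq0 := prim_root_eq0 zm.
have norm_z := norm_unity_root m_gt0 zm1.
have conj_z : z^* = z^-1 by rewrite invC_norm norm_z expr1n invr1 mul1r.
pose w := z ^+ a / z ^+ k.
have -> : \sum_(i < m) (z ^+ i) ^+ a * (z ^+ i)^* ^+ k = \sum_(i < m) w ^+ i.
  apply: eq_bigr => i _.
  by rewrite rmorphXn /= conj_z exprMn !exprVn -!exprM !(mulnC i).
have [ak|ak] := eqVneq a k.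
  rewrite /w ak divff; last by rewrite expf_neq0 // z_neq0 -lt0n.
  by under eq_bigr do rewrite expr1n; rewrite sumr_const card_ord.
have w_neq1 : w - 1 != 0.
  rewrite subr_eq0; apply: contra ak => /eqP w1.
  suff /eqP : z ^+ a = z ^+ k by rewrite (eq_prim_root_expr zm) !modn_small.
  by rewrite -[RHS]mul1r -w1 divfK // expf_neq0 // z_neq0 -lt0n.
have wm1 : w ^+ m = 1.
  by rewrite exprMn exprVn -!exprM !(mulnC _ m) !exprM zm1 !expr1n divr1.
by apply: (mulfI w_neq1); rewrite -subrX1 wm1 subrr mulr0.
Qed.

(** Expanding [Upsilon m] and exchanging the sums, orthogonality keeps only [k = a], where the
    factor [m] cancels [m%:R^-1]. Stated for polynomials so that it transfers to any operator. *)
Lemma Upsilon_interpolation m z a : m.-primitive_root z -> (a < m)%N ->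
  \sum_(i < m) (z ^+ i) ^+ a *: (Upsilon m \Po ((z ^+ i)^* *: 'X)) = 'X^a.
Proof.
move=> zm am; have m_neq0 : m%:R != 0 :> C.
  by rewrite pnatr_eq0 -lt0n (prim_order_gt0 zm).
rewrite (eq_bigr (fun i : 'I_m => m%:R^-1 *: \sum_(k < m)
  ((z ^+ i) ^+ a * (z ^+ i)^* ^+ k) *: 'X^k)); last first.
  move=> i _; rewrite /Upsilon comp_polyZ scalerA mulrC -scalerA; congr (_ *: _).
  rewrite linear_sum /= scaler_sumr; apply: eq_bigr => k _.
  by rewrite comp_Xn_poly exprZn scalerA.
rewrite -scaler_sumr exchange_big /= (bigD1 (Ordinal am)) //=.
rewrite [X in _ + X]big1 => [|k ka].
  rewrite -scaler_suml (prim_root_orthogonality zm) // eqxx mulr1n addr0.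
  by rewrite scalerA mulVf // scale1r.
rewrite -scaler_suml (prim_root_orthogonality zm) // -val_eqE /= eq_sym in ka *.
by rewrite (negbTE ka) mulr0n scale0r.
Qed.
End RootsOfUnity.

(** * Divided differences in one variable *)

Section DividedDifferences.

(* The complete homogeneous polynomial [\sum_(a + b = n - 1) x ^+ a * y ^+ b];
   it is 0 for [n = 0], where the predecessors below are junk. *)
Definition hsum (A : comNzRingType) (x y : A) n : A :=
  \sum_(a < n) x ^+ (n.-1 - a) * y ^+ a.

Lemma horner_sub_hsum (A : comNzRingType) (q : {poly A}) n x y :
  (size q <= n)%N ->
  q.[x] - q.[y] = (x - y) * \sum_(j < n) q`_j * hsum x y j.
Proof.
move=> qn; rewrite !(horner_coef_wide _ qn) -sumrB mulr_sumr.
by apply: eq_bigr => j _; rewrite -mulrBr subrXX mulrCA.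
Qed.

(** On the diagonal [hsum x x j] is [j] copies of [x ^+ j.-1], so the confluent case takes the same
    form as the case of distinct points. *)
Lemma horner_deriv_hsum (A : comNzRingType) (q : {poly A}) n x :
  (size q <= n)%N -> q^`().[x] = \sum_(j < n) q`_j * hsum x x j.
Proof.
move=> qn; rewrite -{1}(coefK q) (poly_def (size q)).
have -> : \sum_(i < size q) q`_i *: 'X^i = \sum_(i < n) q`_i *: 'X^i :> {poly A}.
  rewrite (big_ord_widen n (fun i => q`_i *: 'X^i)) // big_mkcond /=.
  by apply: eq_bigr => i _; case: ltnP => // ni; rewrite nth_default ?scale0r.
rewrite linear_sum horner_sum; apply: eq_bigr => j _.
rewrite /= derivZ derivXn hornerZ hornerMn hornerXn; congr (_ * _).
rewrite /hsum (eq_bigr (fun=> x ^+ j.-1)).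
  by rewrite sumr_const card_ord.
move=> [a /= aj] _; rewrite -exprD subnK //.
(* The bound [a < j] excludes [j = 0], where [j.-1] is truncated. *)
by case: (nat_of_ord j) aj.
Qed.

End DividedDifferences.

(** * Divided differences of a two-variable polynomial *)

Section DivdiffPoly.
Context {C : numClosedFieldType}.
Implicit Types (m : nat) (f : {poly {poly C}}).

Lemma hsumC (x y : C) n : hsum x%:P y%:P n = (hsum x y n)%:P.
Proof.
rewrite /hsum rmorph_sum; apply: eq_bigr => a _.
by rewrite rmorphM !rmorphXn.
Qed.

(** One formula covers both branches of the definition: the one-variable identities are applied over
    the ring [{poly C}] at the constants [x%:P] and [y%:P]. *)
Lemma divdiff1_poly_hsum m f x y : degree_le m f ->
  divdiff1_poly f x y = \sum_(j < m.+1) hsum x y j *: f`_j.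
Proof.
move=> [fm _]; rewrite /divdiff1_poly /fix_zeta.
have scaleE (u v : C) : \sum_(j < m.+1) f`_j * hsum u%:P v%:P j =
    \sum_(j < m.+1) hsum u v j *: f`_j.
  by apply: eq_bigr => j _; rewrite hsumC mulrC mul_polyC.
case: eqP => [<-|/eqP xy]; first by rewrite (horner_deriv_hsum _ fm) scaleE.
rewrite (horner_sub_hsum _ _ fm) scaleE -polyCB mul_polyC scalerA mulVf.
  by rewrite scale1r.
by rewrite subr_eq0.
Qed.

Lemma divdiff2_poly_hsum m f x y : degree_le m f ->
  divdiff2_poly f x y =
    \sum_(k < m.+1) hsum x y k *: map_poly (coefp k) f.
Proof.
move=> [_ fm]; apply/polyP => j.
rewrite coef_sum (eq_bigr (fun k : 'I_m.+1 => f`_j`_k * hsum x y k)); last first.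
  by move=> k _; rewrite coefZ coef_map mulrC.
rewrite /divdiff2_poly /fix_tau /dtau; case: eqP => [<-|/eqP xy].
  rewrite coef_map coef_map_id0 ?deriv0 // -(horner_deriv_hsum _ (fm j)).
  by [].
rewrite coefZ coefB !coef_map /horner_eval (horner_sub_hsum _ _ (fm j)).
by rewrite mulrA mulVf ?mul1r // subr_eq0.
Qed.

End DivdiffPoly.

(** * Polynomials of one operator *)

Section OperatorCalculus.
Context {C : numClosedFieldType} {H : normedModType C}.
Implicit Types (T S : {linear H -> H}) (p : {poly C}) (f : {poly {poly C}}).

Lemma iter_is_linear n T : linear (iter n T).
Proof. by move=> c x y; elim: n => //= n ->; rewrite linearP. Qed.

HB.instance Definition _ n T :=
  GRing.isLinear.Build C H H *:%R (iter n T) (iter_is_linear n T).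

Lemma op_eval_wide n p (T : H -> H) x : (size p <= n)%N ->
  op_eval p T x = \sum_(k < n) p`_k *: iter k T x.
Proof.
move=> pn; rewrite /op_eval fct_sumE /=.
rewrite (big_ord_widen n (fun k => p`_k *: iter k T x)) // big_mkcond /=.
by apply: eq_bigr => i _; case: ltnP => // ni; rewrite nth_default ?scale0r.
Qed.

Lemma op_eval_is_linear p T : linear (op_eval p T).
Proof.
move=> c x y; rewrite !(op_eval_wide _ _ (leqnn (size p))) scaler_sumr -big_split.
by apply: eq_bigr => k _; rewrite linearP scalerDr !scalerA mulrC.
Qed.

HB.instance Definition _ p T :=
  GRing.isLinear.Build C H H *:%R (op_eval p T) (op_eval_is_linear p T).

Lemma op_eval_lincomb n (c : 'I_n -> C) (p : 'I_n -> {poly C}) (T : H -> H) x :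
  op_eval (\sum_(i < n) c i *: p i) T x = \sum_(i < n) c i *: op_eval (p i) T x.
Proof.
pose N := (\max_(i < n) size (p i))%N.
have pN i : (size (p i) <= N)%N by exact: leq_bigmax.
have sN : (size (\sum_(i < n) c i *: p i)%R <= N)%N.
  apply: (leq_trans (size_sum _ _ _)); apply/bigmax_leqP => i _.
  by apply: (leq_trans _ (pN i)); apply: size_scale_leq.
rewrite (op_eval_wide _ _ sN); under eq_bigr => k _ do
  rewrite coef_sum scaler_suml.
rewrite exchange_big /=; apply: eq_bigr => i _.
rewrite (op_eval_wide _ _ (pN i)) scaler_sumr; apply: eq_bigr => k _.
by rewrite coefZ scalerA.
Qed.

Lemma op_evalXn n (T : H -> H) x : op_eval 'X^n T x = iter n T x.
Proof.
rewrite (@op_eval_wide n.+1) ?size_polyXn // big_ord_recr /= big1.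
  by rewrite coefXn eqxx scale1r add0r.
by move=> i _; rewrite coefXn ltn_eqF // scale0r.
Qed.

(** Moves the scalar from the operator into the polynomial, where interpolation is available;
    linearity of [T] gives (cT)^k = c^k T^k. *)
Lemma op_eval_scale p T c :
  op_eval p (c *: (T : H -> H)) = op_eval (p \Po (c *: 'X)) T.
Proof.
apply/funext => x.
rewrite comp_polyE op_eval_lincomb (op_eval_wide _ _ (leqnn (size p))).
apply: eq_bigr => k _; congr (_ *: _).
(* The one-term sum gives the shape that [op_eval_lincomb] rewrites. *)
have -> : (c *: 'X) ^+ k = \sum_(i < 1) c ^+ k *: 'X^k :> {poly C}.
  by rewrite big_ord1 exprZn.
rewrite op_eval_lincomb big_ord1 op_evalXn.
elim: (nat_of_ord k) => [|n IH]; first by rewrite expr0 scale1r.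
by rewrite iterS IH scalrfctE linearZ /= scalerA exprS.
Qed.

Lemma linear_comp3_lincomb (A D B : {linear H -> H}) n
    (c : 'I_n -> C) (u : 'I_n -> H) :
  A (D (B (\sum_(i < n) c i *: u i))) = \sum_(i < n) c i *: A (D (B (u i))).
Proof.
rewrite 3!linear_sum; apply: eq_bigr => i _.
by rewrite linearZ linearZ linearZ.
Qed.

(** * Telescoping of powers and its interpolated form *)

Lemma iter_sub_telescope n T S x :
  iter n T x - iter n S x =
    \sum_(a < n) iter (n.-1 - a) T (T (iter a S x) - S (iter a S x)).
Proof.
elim: n => [|n IH]; first by rewrite big_ord0 subrr.
rewrite big_ord_recr /= subnn /= (eq_bigr (fun a : 'I_n =>
  T (iter (n.-1 - a) T (T (iter a S x) - S (iter a S x))))); last first.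
  (* Since [a < n], the truncated subtractions are exact and one factor [T] splits off on the
     left. *)
  move=> [a /= an] _; have -> : (n - a = (n.-1 - a).+1)%N by lia.
  by rewrite iterS.
by rewrite -linear_sum -IH linearB addrA subrK.
Qed.

Lemma sum_Upsilon_telescope m z n T S x :
  m.-primitive_root z -> (n <= m)%N ->
  \sum_(i < m) \sum_(l < m) hsum (z ^+ i) (z ^+ l) n *:
    op_eval (Upsilon m \Po ((z ^+ i)^* *: 'X)) T
      ((T \- S) (op_eval (Upsilon m \Po ((z ^+ l)^* *: 'X)) S x)) =
  iter n T x - iter n S x.
Proof.
move=> zm nm; pose U i := Upsilon m \Po ((z ^+ i)^* *: 'X).
have interp a (L : H -> H) y : (a < m)%N ->
    \sum_(i < m) (z ^+ i) ^+ a *: op_eval (U i) L y = iter a L y.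
  by move=> am; rewrite -op_eval_lincomb Upsilon_interpolation // op_evalXn.
rewrite iter_sub_telescope.
(* Expanding [hsum] separates the two nodes: the one at [T] carries the exponent [n.-1 - a], the one
   at [S] carries [a]. Linearity moves the inner sum inside. *)
transitivity (\sum_(a < n) \sum_(i < m) (z ^+ i) ^+ (n.-1 - a) *:
    op_eval (U i) T ((T \- S)
      (\sum_(l < m) (z ^+ l) ^+ a *: op_eval (U l) S x))).
  rewrite [RHS]exchange_big; apply: eq_bigr => i _.
  under [RHS]eq_bigr => a _ do rewrite 2!linear_sum scaler_sumr.
  rewrite [RHS]exchange_big; apply: eq_bigr => l _.
  rewrite /hsum scaler_suml; apply: eq_bigr => a _.
  by rewrite [X in _ = _ *: op_eval _ _ X]linearZ [X in _ = _ *: X]linearZ scalerA.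
apply: eq_bigr => -[a /= an] _.
(* Both exponents are below [m] because [a < n <= m]. *)
by rewrite !interp //; lia.
Qed.

(** * Polynomials of two operators and the two difference formulas *)

Lemma op_eval2_wide m f (T S : H -> H) x : degree_le m f ->
  op_eval2 f T S x =
    \sum_(j < m.+1) \sum_(k < m.+1) f`_j`_k *: iter j T (iter k S x).
Proof.
move=> [fm fjm]; pose F j := \sum_(k < m.+1) f`_j`_k *: iter j T (iter k S x).
transitivity (\sum_(j < size f) F j).
  rewrite /op_eval2 fct_sumE; apply: eq_bigr => j _; rewrite fct_sumE.
  rewrite (big_ord_widen m.+1 (fun k => f`_j`_k *: iter j T (iter k S x))) //.
  rewrite big_mkcond /=; apply: eq_bigr => k _.
  by case: ltnP => // jk; rewrite nth_default ?scale0r.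
rewrite (big_ord_widen m.+1 F) // big_mkcond /=; apply: eq_bigr => j _.
case: ltnP => // jk; rewrite big1 // => k _.
by rewrite (nth_default _ jk) coef0 scale0r.
Qed.

(** Grouping by powers of zeta leaves bare powers of [T] on the left, where the telescoping formula
    acts. *)
Lemma op_eval2_zeta m f T (S : H -> H) x : degree_le m f ->
  op_eval2 f T S x = \sum_(j < m.+1) iter j T (op_eval f`_j S x).
Proof.
move=> fm; rewrite (op_eval2_wide _ _ _ fm); apply: eq_bigr => j _.
rewrite (op_eval_wide _ _ (fm.2 j)) linear_sum; apply: eq_bigr => k _.
by rewrite linearZ.
Qed.

(** Grouping by powers of tau leaves bare powers of [S] on the right, next to the vector. *)
Lemma op_eval2_tau m f T (S : H -> H) x : degree_le m f ->
  op_eval2 f T S x =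
    \sum_(k < m.+1) op_eval (map_poly (coefp k) f) T (iter k S x).
Proof.
move=> fm; rewrite (op_eval2_wide _ _ _ fm) exchange_big; apply: eq_bigr => k _.
rewrite (@op_eval_wide m.+1); last exact: leq_trans (size_poly _ _) fm.1.
by apply: eq_bigr => j _; rewrite coef_map.
Qed.

Lemma op_eval2_sub_zeta m f T S (L : H -> H) : (0 < m)%N -> degree_le m f ->
  op_eval2 f T L - op_eval2 f S L =
     \sum_(xi \in unit_roots m) \sum_(eta \in unit_roots m)
       (op_eval (Upsilon m) (xi^* *: (T : H -> H)) \o
        ((T : H -> H) - (S : H -> H)) \o
        op_eval (Upsilon m) (eta^* *: (S : H -> H)) \o
        op_eval (divdiff1_poly f xi eta) L).
Proof.
move=> m_gt0 fm; have [z zm] := @closed_prim_root_exists C m m_gt0.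
rewrite (fsbig_unit_roots _ zm); under eq_bigr do rewrite (fsbig_unit_roots _ zm).
apply/funext => x; rewrite fct_sumE; under [RHS]eq_bigr do rewrite fct_sumE /=.
transitivity (op_eval2 f T L x - op_eval2 f S L x); first by [].
rewrite !(op_eval2_zeta _ _ _ fm) -sumrB.
rewrite (eq_bigr (fun j : 'I_m.+1 => \sum_(i < m) \sum_(l < m)
    hsum (z ^+ i) (z ^+ l) j *:
    op_eval (Upsilon m \Po ((z ^+ i)^* *: 'X)) T
      ((T \- S) (op_eval (Upsilon m \Po ((z ^+ l)^* *: 'X)) S
        (op_eval f`_j L x))))); last first.
  by move=> j _; rewrite (sum_Upsilon_telescope _ _ _ zm) // -ltnS.
rewrite exchange_big; apply: eq_bigr => i _.
rewrite exchange_big; apply: eq_bigr => l _ /=.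
rewrite !op_eval_scale (divdiff1_poly_hsum _ _ fm) op_eval_lincomb.
by rewrite -[(T : H -> H) - (S : H -> H)]/(T \- S) linear_comp3_lincomb.
Qed.

Lemma op_eval2_sub_tau m f T S (L : {linear H -> H}) :
  (0 < m)%N -> degree_le m f ->
  op_eval2 f L T - op_eval2 f L S =
     \sum_(xi \in unit_roots m) \sum_(eta \in unit_roots m)
       (op_eval (divdiff2_poly f xi eta) L \o
        op_eval (Upsilon m) (xi^* *: (T : H -> H)) \o
        ((T : H -> H) - (S : H -> H)) \o
        op_eval (Upsilon m) (eta^* *: (S : H -> H))).
Proof.
move=> m_gt0 fm; have [z zm] := @closed_prim_root_exists C m m_gt0.
rewrite (fsbig_unit_roots _ zm); under eq_bigr do rewrite (fsbig_unit_roots _ zm).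
apply/funext => x; rewrite fct_sumE; under [RHS]eq_bigr do rewrite fct_sumE /=.
transitivity (op_eval2 f L T x - op_eval2 f L S x); first by [].
rewrite !(op_eval2_tau _ _ _ fm) -sumrB.
rewrite (eq_bigr (fun k : 'I_m.+1 => \sum_(i < m) \sum_(l < m)
    hsum (z ^+ i) (z ^+ l) k *: op_eval (map_poly (coefp k) f) L
    (op_eval (Upsilon m \Po ((z ^+ i)^* *: 'X)) T
      ((T \- S) (op_eval (Upsilon m \Po ((z ^+ l)^* *: 'X)) S x))))); last first.
  move=> k _; have km : (k <= m)%N by rewrite -ltnS.
  (* The difference of powers is formed under the polynomial in [L], whose linearity then lets the
     interpolation sums out. *)
  transitivity (op_eval (map_poly (coefp k) f) L (iter k T x - iter k S x)).
    by rewrite linearB.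
  rewrite -(sum_Upsilon_telescope T S x zm km).
  rewrite linear_sum; apply: eq_bigr => i _; rewrite linear_sum.
  by apply: eq_bigr => l _; rewrite linearZ.
(* The sum over [k] now recombines into [divdiff2_poly f xi eta], applied last. *)
rewrite exchange_big; apply: eq_bigr => i _.
rewrite exchange_big; apply: eq_bigr => l _ /=.
by rewrite !op_eval_scale (divdiff2_poly_hsum _ _ fm) op_eval_lincomb.
Qed.

End OperatorCalculus.

Theorem theorem4p4 (R : realType) (H : completeNormedModType R[i])
    (inner : {dot H for Num.conj})
    (inner_norm : forall x : H, inner x x = `|x| ^+ 2)
    (m : nat) (m_ge1 : (1 <= m)%N)
    (T0 R0 T1 R1 : {linear H -> H})
    (T0_contr : contraction_op T0) (R0_contr : contraction_op R0)
    (T1_contr : contraction_op T1) (R1_contr : contraction_op R1)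
    (f : {poly {poly R[i]}}) (f_deg : degree_le m f) :
  (op_eval2 f T1 R1 - op_eval2 f T0 R1 =
     \sum_(xi \in unit_roots m) \sum_(eta \in unit_roots m)
       (op_eval (Upsilon m) (xi^* *: (T1 : H -> H)) \o
        ((T1 : H -> H) - (T0 : H -> H)) \o
        op_eval (Upsilon m) (eta^* *: (T0 : H -> H)) \o
        op_eval (divdiff1_poly f xi eta) R1)) /\
  (op_eval2 f T0 R1 - op_eval2 f T0 R0 =
     \sum_(xi \in unit_roots m) \sum_(eta \in unit_roots m)
       (op_eval (divdiff2_poly f xi eta) T0 \o
        op_eval (Upsilon m) (xi^* *: (R1 : H -> H)) \o
        ((R1 : H -> H) - (R0 : H -> H)) \o
        op_eval (Upsilon m) (eta^* *: (R0 : H -> H)))).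
Proof.
by split; [exact: op_eval2_sub_zeta | exact: op_eval2_sub_tau].
Qed.
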